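(* Let $(\Omega,\mathcal B,\mu)$ be a probability space and let $(M_\Omega,e_I)$ be a measurable field of $\mathcal L$-structures over it, with direct integral $M_{\Omega,I}=\int^\oplus_\Omega M_\omega\,d\mu(\omega)$. Then for every affine $\mathcal L$-formula $\varphi(x)$ and every tuple $\bar f$ of elements of $M_{\Omega,I}$ (of the length of $x$), the function $\omega\mapsto\varphi^{M_\omega}(\bar f(\omega))$ is $\mu$-measurable and $$\varphi^{M_{\Omega,I}}(\bar f)=\int_\Omega \varphi^{M_\omega}(\bar f(\omega))\,d\mu(\omega).$$
   Context: Affine logic: a signature $\mathcal L$ has function and predicate symbols with arities, compact value intervals for predicates, continuity moduli (convex functions $\delta:[0,\infty)\to[0,\infty)$ vanishing only at $0$), and a distinguished distance predicate $d$; $\mathcal L$-structures are non-empty complete metric spaces with interpretations respecting bounds and moduli; finite products carry the sum metric. Affine formulas are built from atomic formulas by real affine combinations and the quantifiers $\sup,\inf$. For $\mathcal L_0\subseteq\mathcal L$, $N\preceq^{\mathrm{aff}}_{\mathcal L_0}M$ means $N\subseteq M$ is closed under the function symbols of $\mathcal L_0$ and every affine $\mathcal L_0$-formula takes the same values at tuples of $N$ in $N$ and in $M$. Measurable fields: given a probability space $(\Omega,\mathcal B,\mu)$, a field of structures is a family $M_\Omega=(M_\omega)_{\omega\in\Omega}$; a section is an element of $\prod_\omega M_\omega$; a pointwise enumeration is a family of sections $e_I=(e_i)_{i\in I}$ such that $\{e_i(\omega):i\in I\}$ is dense in $M_\omega$ for all $\omega$. For countable $I_0\subseteq I$ let $M_{\omega,I_0}$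 be the closure of $\{e_i(\omega):i\in I_0\}$. The pair $(M_\Omega,e_I)$ is a measurable field if: (1) for each predicate symbol $P$ (including $d$) and tuple $\bar e$ from $e_I$, $\omega\mapsto P^{M_\omega}(\bar e(\omega))$ is measurable; (2) for each function symbol $F$, tuple $\bar e$ from $e_I$ and $i\in I$, $\omega\mapsto d(F^{M_\omega}(\bar e(\omega)),e_i(\omega))$ is measurable; (3) for every finite $\mathcal L_0\subseteq\mathcal L$, the countable sets $I_0\subseteq I$ such that $M_{\omega,I_0}\preceq^{\mathrm{aff}}_{\mathcal L_0}M_\omega$ for $\mu$-a.e. $\omega$ are cofinal (under inclusion) among all countable subsets of $I$. A section $f$ is measurable if for some countable $I_0\subseteq I$, $f(\omega)\in M_{\omega,I_0}$ a.s. and $\omega\mapsto d(f(\omega),e_i(\omega))$ is measurable for all $i\in I_0$. The direct integral $M_{\Omega,I}=\int^\oplus_\Omega M_\omega\,d\mu$ is the set of measurable sections modulo a.e. equality, with metric $d(f,g)=\int_\Omega d(f(\omega),g(\omega))\,d\mu$, function symbols interpreted pointwise, and each predicate symbol by $P(\bar f)=\int_\Omega P^{M_\omega}(\bar f(\omega))\,d\mu$; this is an $\mathcal L$-structure. *)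

(* Defs.v *)
From HB Require Import structures.
From mathcomp Require Import all_boot all_order all_algebra.
From mathcomp Require Import all_classical all_reals all_analysis.
From mathcomp Require Import measurable_realfun ring lra.
Import Order.TTheory GRing.Theory Num.Theory.
Import numFieldNormedType.Exports.

Set Implicit Arguments.
Unset Strict Implicit.
Unset Printing Implicit Defensive.

Local Open Scope classical_set_scope.
Local Open Scope ring_scope.

(* Only the values on [0, +oo[ of a modulus matter. *)
Definition continuity_modulus (R : realType) (delta : R -> R) : Prop :=
  [/\ @convex_function R R^o `[0, +oo[ delta,
      forall t, 0 <= t -> 0 <= delta t &
      forall t, 0 <= t -> (delta t = 0 <-> t = 0)].

(* The predicate symbols of a signature are [None], which is the distinguished *)
(* binary distance symbol, and [Some P] for [P : rel_sym].                     *)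
Record signature (R : realType) := Signature {
  fun_sym : Type;
  rel_sym : Type;
  fun_arity : fun_sym -> nat;
  rel_arity : rel_sym -> nat;
  fun_modulus : fun_sym -> R -> R;
  pred_modulus : option rel_sym -> R -> R;
  pred_lo : option rel_sym -> R;
  pred_hi : option rel_sym -> R;
  fun_modulusP : forall F, continuity_modulus (fun_modulus F);
  pred_modulusP : forall P, continuity_modulus (pred_modulus P);
  pred_lo_hi : forall P, pred_lo P <= pred_hi P
}.

Definition pred_sym (R : realType) (L : signature R) := option (rel_sym L).

Definition pred_arity (R : realType) (L : signature R) (P : pred_sym L) : nat :=
  if P is Some Q then rel_arity Q else 2.

Definition sum_dist (R : realType) (X : metricType R) (n : nat)
    (v w : 'I_n -> X) : R :=
  \sum_(j < n) mdist (v j) (w j).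

(* A map [g] has modulus [delta] when [delta (d (g v) (g w)) <= d v w].  As    *)
(* [delta] is continuous and increasing, this is the same as                   *)
(* [d v w < delta eps -> d (g v) (g w) <= eps] for all [eps].                  *)
Record structure (R : realType) (L : signature R) := Structure {
  carrier :> metricType R;
  fun_interp : forall F : fun_sym L, ('I_(fun_arity F) -> carrier) -> carrier;
  pred_interp : forall P : pred_sym L, ('I_(pred_arity P) -> carrier) -> R;
  structure_nonempty : exists x : carrier, True;
  structure_complete : forall u : nat -> carrier,
    cauchy (u @ \oo) -> exists x : carrier, u @ \oo --> x;
  pred_interp_dist : forall v : 'I_2 -> carrier,
    @pred_interp None v = mdist (v ord0) (v ord_max);
  pred_interp_bounds : forall (P : pred_sym L) (v : 'I_(pred_arity P) -> carrier),
    pred_lo P <= @pred_interp P v <= pred_hi P;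
  fun_interp_modulus : forall (F : fun_sym L) (v w : 'I_(fun_arity F) -> carrier),
    fun_modulus F (mdist (@fun_interp F v) (@fun_interp F w)) <= sum_dist v w;
  pred_interp_modulus : forall (P : pred_sym L) (v w : 'I_(pred_arity P) -> carrier),
    pred_modulus P `|@pred_interp P v - @pred_interp P w| <= sum_dist v w
}.
Arguments fun_interp {R L} s F v.
Arguments pred_interp {R L} s P v.

(* Affine formulas; [formula L n] has its free variables among [n] variables,  *)
(* and the quantifiers bind the variable [ord0] of their scope.                *)
Inductive term (R : realType) (L : signature R) (n : nat) : Type :=
| Var of 'I_n
| App (F : fun_sym L) of ('I_(fun_arity F) -> term L n).

Inductive formula (R : realType) (L : signature R) : nat -> Type :=
| Atom n (P : pred_sym L) of ('I_(pred_arity P) -> term L n) : formula L n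
| Const n of R : formula L n
| Add n of formula L n & formula L n : formula L n
| Scale n of R & formula L n : formula L n
| Sup n of formula L n.+1 : formula L n
| Inf n of formula L n.+1 : formula L n.

Fixpoint term_value (R : realType) (L : signature R) (M : structure L) (n : nat)
    (v : 'I_n -> M) (t : term L n) : M :=
  match t with
  | Var i => v i
  | App F a => fun_interp M F (fun j => term_value v (a j))
  end.

Definition extend (X : Type) (n : nat) (x : X) (v : 'I_n -> X) : 'I_n.+1 -> X :=
  fun i => if unlift ord0 i is Some j then v j else x.

(* Value of a formula with quantifiers relativized to [A]: for [v] in a subset *)
(* [A] closed under the function symbols of [phi], the value in [A].  Values   *)
(* of formulas are bounded, so [sup] and [inf] are genuine when [A] is         *)
(* nonempty.                                                                   *)
Fixpoint value_in (R : realType) (L : signature R) (M : structure L)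
    (A : set M) (n : nat) (phi : formula L n) : ('I_n -> M) -> R :=
  match phi in formula _ k return ('I_k -> M) -> R with
  | Atom _ P a => fun v => pred_interp M P (fun j => term_value v (a j))
  | Const _ r => fun=> r
  | Add _ phi psi => fun v => value_in A phi v + value_in A psi v
  | Scale _ r phi => fun v => r * value_in A phi v
  | Sup _ phi => fun v => sup [set value_in A phi (extend x v) | x in A]
  | Inf _ phi => fun v => inf [set value_in A phi (extend x v) | x in A]
  end.

Definition value (R : realType) (L : signature R) (M : structure L) (n : nat)
    (phi : formula L n) (v : 'I_n -> M) : R :=
  value_in [set: M] phi v.
Arguments value {R L} M {n} phi v.

(* A subsignature is given by its function symbols [F0] and its predicate      *)
(* symbols [P0] other than the distance, which belongs to every subsignature.  *)
Section subsignature.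
Variables (R : realType) (L : signature R).
Variables (F0 : set (fun_sym L)) (P0 : set (rel_sym L)).

Fixpoint term_over (n : nat) (t : term L n) : Prop :=
  match t with
  | Var _ => True
  | App F a => F0 F /\ forall j, term_over (a j)
  end.

Definition pred_over (P : pred_sym L) : Prop := if P is Some Q then P0 Q else True.

Fixpoint formula_over (n : nat) (phi : formula L n) : Prop :=
  match phi with
  | Atom _ P a => pred_over P /\ forall j, term_over (a j)
  | Const _ _ => True
  | Add _ phi psi => formula_over phi /\ formula_over psi
  | Scale _ _ phi => formula_over phi
  | Sup _ phi => formula_over phi
  | Inf _ phi => formula_over phi
  end.

Definition affine_substructure (M : structure L) (N : set M) : Prop :=
  [/\ N !=set0,
      forall F, F0 F -> forall v : 'I_(fun_arity F) -> M,
        (forall j, N (v j)) -> N (fun_interp M F v) &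
      forall n (phi : formula L n), formula_over phi ->
        forall v : 'I_n -> M, (forall j, N (v j)) ->
        value_in N phi v = value M phi v].

End subsignature.

(* Measurability with respect to the completion of [mu].  Every measurability  *)
(* requirement below is of this form: with strict measurability, applying a    *)
(* function symbol pointwise to measurable sections could leave the measurable *)
(* sections on a null set.                                                     *)
Definition mu_measurable (R : realType) d (T : measurableType d)
    (mu : {measure set T -> \bar R}) (f : T -> R) : Prop :=
  exists2 g : T -> R, measurable_fun [set: T] g & f = g %[ae mu].

Section measurable_field.
Variables (R : realType) (L : signature R) (d : measure_display).
Variables (T : measurableType d) (mu : probability T R).
Variables (M : T -> structure L) (I : Type) (e : I -> forall w, M w).

Definition generated (I0 : set I) (w : T) : set (M w) :=
  closure [set e i w | i in I0].
Arguments generated I0 w : clear implicits.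

Record measurable_field : Prop := MeasurableField {
  field_dense : forall w, dense [set e i w | i in [set: I]];
  field_pred : forall (P : pred_sym L) (k : 'I_(pred_arity P) -> I),
    mu_measurable mu (fun w => pred_interp (M w) P (fun j => e (k j) w));
  field_fun : forall (F : fun_sym L) (k : 'I_(fun_arity F) -> I) (i : I),
    mu_measurable mu
      (fun w => mdist (fun_interp (M w) F (fun j => e (k j) w)) (e i w));
  field_cofinal : forall (F0 : set (fun_sym L)) (P0 : set (rel_sym L)),
    finite_set F0 -> finite_set P0 ->
    forall J : set I, countable J ->
    exists I0 : set I, [/\ countable I0, J `<=` I0 &
      \forall w \ae mu, affine_substructure F0 P0 (generated I0 w)]
}.

Definition measurable_section (f : forall w, M w) : Prop :=
  exists I0 : set I, [/\ countable I0,
    \forall w \ae mu, generated I0 w (f w) &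
    forall i, I0 i -> mu_measurable mu (fun w => mdist (f w) (e i w))].

End measurable_field.

Section modulus.
Variables (R : realType) (delta : R -> R).
Hypothesis dP : continuity_modulus delta.

Lemma modulus_convex (x y t : R) : 0 <= x -> 0 <= y -> 0 <= t -> t <= 1 ->
  delta (t * x + (1 - t) * y) <= t * delta x + (1 - t) * delta y.
Proof.
case: dP => cd _ _ x0 y0 t0 t1.
have t01 : (Itv.spec (@Itv.num_sem R) (Itv.Real `[0, 1]%Z) t).
  by rewrite /= /Itv.num_sem/= in_itv/= t0 t1 num_real.
have := cd (Itv.mk t01) x y.
rewrite !inE/= !in_itv/= !andbT => /(_ x0 y0).
by rewrite !convRE.
Qed.

Lemma modulus_gt0 t : 0 < t -> 0 < delta t.
Proof.
case: dP => _ d0 dz t0; rewrite lt_neqAle d0 ?ltW// andbT eq_sym.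
by apply/eqP => /(dz _ (ltW t0)) t0'; rewrite t0' ltxx in t0.
Qed.

Lemma modulus0 : delta 0 = 0.
Proof. by case: dP => _ _ dz; apply/dz. Qed.

Lemma modulus_ge0 t : 0 <= t -> 0 <= delta t.
Proof. by case: dP => _ d0 _; exact: d0. Qed.

Lemma modulus_mono x y : 0 <= x -> x <= y -> delta x <= delta y.
Proof.
move=> x0 xy; have [y0|y0] := eqVneq y 0.
  have -> : x = 0 by apply/eqP; rewrite eq_le x0 -y0 xy.
  by rewrite y0.
have {y0}y0 : 0 < y by rewrite lt_neqAle eq_sym y0 (le_trans x0 xy).
have xy0 : 0 <= x / y by rewrite divr_ge0// ltW.
have xy1 : x / y <= 1 by rewrite ler_pdivrMr// mul1r.
have := @modulus_convex y 0 (x / y) (ltW y0) (lexx _) xy0 xy1.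
rewrite modulus0 !mulr0 !addr0 divfK ?gt_eqF// => /le_trans; apply.
by rewrite ler_piMl// modulus_ge0// ltW.
Qed.

Lemma modulus_lt a eps : 0 < eps -> delta a < delta eps -> a < eps.
Proof.
move=> e0; apply: contraTT; rewrite -!leNgt => ea.
by rewrite modulus_mono// ltW.
Qed.

Lemma modulus_support t0 : 0 < t0 ->
  exists s, forall t, 0 <= t -> delta t0 + s * (t - t0) <= delta t.
Proof.
move=> t00.
pose S := [set (delta t0 - delta t) / (t0 - t) | t in [set t | 0 <= t < t0]].
have slope (t u : R) : 0 <= t -> t < t0 -> t0 < u ->
    (delta t0 - delta t) / (t0 - t) <= (delta u - delta t0) / (u - t0).
  move=> t_ge0 tt0 t0u.
  have ut : 0 < u - t by lra.
  have tt : 0 < t0 - t by lra.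
  have uu : 0 < u - t0 by lra.
  have u0 : 0 <= u by lra.
  have r0 : 0 <= (u - t0) / (u - t) by rewrite divr_ge0// ltW.
  have r1 : (u - t0) / (u - t) <= 1 by rewrite ler_pdivrMr// mul1r; lra.
  have := @modulus_convex t u ((u - t0) / (u - t)) t_ge0 u0 r0 r1.
  have -> : (u - t0) / (u - t) * t + (1 - (u - t0) / (u - t)) * u = t0.
    by field; rewrite gt_eqF.
  have -> : (u - t0) / (u - t) * delta t + (1 - (u - t0) / (u - t)) * delta u
    = ((u - t0) * delta t + (t0 - t) * delta u) / (u - t).
    by field; rewrite gt_eqF.
  rewrite ler_pdivlMr// => h.
  rewrite ler_pdivrMr// mulrAC ler_pdivlMr//; nra.
have S0 : S !=set0.
  by exists ((delta t0 - delta 0) / (t0 - 0)), 0 => //=; rewrite lexx.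
have Sub : ubound S ((delta (t0 + 1) - delta t0) / (t0 + 1 - t0)).
  by move=> _ [t /= /andP[t1 t2] <-]; apply: slope => //; lra.
exists (sup S) => t t_ge0.
have [tt0|tt0|->] := ltgtP t t0; last by rewrite subrr mulr0 addr0.
- have : (delta t0 - delta t) / (t0 - t) <= sup S.
    by apply: ub_le_sup; [eexists; exact: Sub|exists t => //=; rewrite t_ge0].
  rewrite ler_pdivrMr ?subr_gt0//; nra.
- have : sup S <= (delta t - delta t0) / (t - t0).
    by apply: ge_sup => // _ [u /= /andP[u1 u2] <-]; exact: slope.
  rewrite ler_pdivlMr ?subr_gt0//; nra.
Qed.

End modulus.

Section ae_integral.
Variables (R : realType) (d : measure_display) (T : measurableType d).
Variable mu : probability T R.

Import HBNNSimple.
Local Open Scope ereal_scope.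

Lemma ge0_ae_le_integral (f g : T -> \bar R) (N : set T) :
  measurable N -> mu N = 0 ->
  (forall x, 0 <= f x) -> (forall x, 0 <= g x) ->
  (forall x, ~ N x -> f x = g x) -> \int[mu]_x f x <= \int[mu]_x g x.
Proof.
move=> mN N0 f0 g0 fg.
rewrite [leLHS]ge0_integralTE// [leRHS]ge0_integralTE//.
apply: ge_ereal_sup => _ [h /= hf <-].
pose h' := proj_nnsfun h (measurableC mN).
have -> : sintegral mu h = sintegral mu h'.
  have e1 : \int[mu]_x (h x)%:E = sintegral mu h.
    by rewrite integralT_nnsfun.
  have e2 : \int[mu]_x (h' x)%:E = sintegral mu h'.
    by rewrite integralT_nnsfun.
  rewrite -e1 -e2; apply: ae_eq_integral => //.
    exact/measurable_EFinP.
    exact/measurable_EFinP.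
  exists N; split => //= x /not_implyP[_ hh]; apply: contrapT => Nx.
  by apply: hh; rewrite /h' /= mindicE mem_set// mulr1.
apply: ereal_sup_ubound; exists h' => //= x.
rewrite mindicE; have [xN|xN] := pselect (N x).
  by rewrite memNset/= ?mulr0//; exact/(_ : ~ ~ _)/notK.
by rewrite mem_set//= mulr1 -fg.
Qed.

Lemma ae_integralE (f g : T -> \bar R) : f = g %[ae mu] ->
  \int[mu]_x f x = \int[mu]_x g x.
Proof.
move=> [N [mN N0 fgN]].
have fg x : ~ N x -> f x = g x.
  by move=> Nx; apply: contrapT => fgx; apply/Nx/fgN => /=; exact/not_implyP.
rewrite integralE [RHS]integralE; congr (_ - _);
  apply/eqP; rewrite eq_le; apply/andP; split;
  apply: (ge0_ae_le_integral mN N0) => // x /fg; rewrite ?funeposE ?funenegE;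
  by move=> ->.
Qed.

End ae_integral.

Section mu_measurable_theory.
Variables (R : realType) (d : measure_display) (T : measurableType d).
Variable mu : probability T R.
Local Notation mm := (mu_measurable mu).

Lemma null_set_of (P : T -> Prop) : (\forall w \ae mu, P w) ->
  exists N, [/\ measurable N, mu N = 0%E & forall w, ~ N w -> P w].
Proof.
move=> [N [mN N0 PN]]; exists N; split => // w Nw.
by apply: contrapT => Pw; exact/Nw/PN.
Qed.

Lemma null_bigcup (N : nat -> set T) :
  (forall k, measurable (N k) /\ mu (N k) = 0%E) ->
  measurable (\bigcup_k N k) /\ mu (\bigcup_k N k) = 0%E.
Proof.
move=> NP; have mN : measurable (\bigcup_k N k).
  by apply: bigcupT_measurable => k; case: (NP k).
split=> //; apply: measure_negligible => //; apply: negligible_bigcup => k.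
by case: (NP k) => mk k0; exact/negligibleP.
Qed.

Lemma mu_measurableP f :
  mm f <-> exists N, [/\ measurable N, mu N = 0%E & measurable_fun (~` N) f].
Proof.
split=> [[g mg /null_set_of[N [mN N0 fg]]]|[N [mN N0 mf]]].
  exists N; split => //; apply: (eq_measurable_fun g).
    by move=> x /set_mem /= Nx; rewrite fg.
  exact: measurable_funTS.
exists (f \_ (~` N)).
  by apply/(measurable_restrictT _ _).1 => //; exact: measurableC.
exists N; split => // x /not_implyP[_ h]; apply: contrapT => Nx; apply: h.
by rewrite patchE mem_set.
Qed.

Lemma mu_measurable_common (K : countType) (f : K -> T -> R) (P : T -> Prop) :
  (forall k, mm (f k)) -> (\forall w \ae mu, P w) ->
  exists N, [/\ measurable N, mu N = 0%E,
    forall k, measurable_fun (~` N) (f k) & forall w, ~ N w -> P w].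
Proof.
move=> mf /null_set_of[N0 [mN0 N00 PN0]].
have /choice[N NP] : forall k, exists N,
    [/\ measurable N, mu N = 0%E & measurable_fun (~` N) (f k)].
  by move=> k; exact/mu_measurableP.
pose N' n := if n is n.+1 then
  if unpickle n is Some k then N k else set0 else N0.
have [mN' N'0] : measurable (\bigcup_k N' k) /\ mu (\bigcup_k N' k) = 0%E.
  apply: null_bigcup => -[|n] //=; case: unpickle => [k|]; last by split.
  by case: (NP k).
exists (\bigcup_k N' k); split => // [k|w Nw].
- have [mNk Nk0 mfk] := NP k.
  apply: measurable_funS mfk; first exact: measurableC.
  by apply: subsetC => w Nkw; exists (pickle k).+1 => //=; rewrite pickleK.
- by apply: PN0 => N0w; apply: Nw; exists 0%N.
Qed.

Lemma ae_mu_measurable (f g : T -> R) : (\forall w \ae mu, f w = g w) ->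
  mm f -> mm g.
Proof.
move=> /null_set_of[N [mN N0 fg]] [h mh fh]; exists h => //.
have ae1 : \forall w \ae mu, f w = g w.
  by exists N; split => // w nfg; apply: contrapT => /fg.
by apply: filterS2 ae1 fh => w -> /(_ I) -> .
Qed.

Lemma mu_measurable_cst r : mm (fun=> r).
Proof. by exists (fun=> r) => //; exact: aeW. Qed.

Lemma mu_measurableD f g : mm f -> mm g -> mm (fun w => f w + g w).
Proof.
move=> [f' mf' ff'] [g' mg' gg']; exists (fun w => f' w + g' w).
  exact: measurable_funD.
by apply: filterS2 ff' gg' => w + + _ => -> // ->.
Qed.

Lemma mu_measurableM f g : mm f -> mm g -> mm (fun w => f w * g w).
Proof.
move=> [f' mf' ff'] [g' mg' gg']; exists (fun w => f' w * g' w).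
  exact: measurable_funM.
by apply: filterS2 ff' gg' => w + + _ => -> // ->.
Qed.

Lemma mu_measurable_norm f : mm f -> mm (fun w => `|f w|).
Proof.
move=> [f' mf' ff']; exists (fun w => `|f' w|).
  exact: measurableT_comp.
by apply: filterS ff' => w + _ => ->.
Qed.

Lemma mu_measurableB f g : mm f -> mm g -> mm (fun w => f w - g w).
Proof.
move=> mf mg; have := mu_measurableD mf (mu_measurableM (mu_measurable_cst (-1)) mg).
by under [X in mu_measurable _ X -> _]eq_fun do rewrite mulN1r.
Qed.

Lemma mu_measurable_sum n (f : 'I_n -> T -> R) : (forall j, mm (f j)) ->
  mm (fun w => \sum_(j < n) f j w).
Proof.
elim: n f => [f _|n ih f mf].
  by under eq_fun do rewrite big_ord0; exact: mu_measurable_cst.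
under eq_fun do rewrite big_ord_recr.
by apply: mu_measurableD => //; exact: ih.
Qed.


Definition bmm (f : T -> R) := mm f /\ exists C, forall w, `|f w| <= C.

Lemma bmm_cst r : bmm (fun=> r).
Proof. by split; [exact: mu_measurable_cst|exists `|r|]. Qed.

Lemma bmmD f g : bmm f -> bmm g -> bmm (fun w => f w + g w).
Proof.
move=> [mf [C fC]] [mg [D gD]]; split; first exact: mu_measurableD.
by exists (C + D) => w; rewrite (le_trans (ler_normD _ _))// lerD.
Qed.

Lemma bmmM f g : bmm f -> bmm g -> bmm (fun w => f w * g w).
Proof.
move=> [mf [C fC]] [mg [D gD]]; split; first exact: mu_measurableM.
by exists (C * D) => w; rewrite normrM ler_pM.
Qed.

Lemma bmmB f g : bmm f -> bmm g -> bmm (fun w => f w - g w).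
Proof.
move=> bf bg; have := bmmD bf (bmmM (bmm_cst (-1)) bg).
by under [X in bmm X -> _]eq_fun do rewrite mulN1r.
Qed.

Lemma bmm_norm f : bmm f -> bmm (fun w => `|f w|).
Proof.
move=> [mf [C fC]]; split; first exact: mu_measurable_norm.
by exists C => w; rewrite normr_id.
Qed.

Lemma bmm_sum n (f : 'I_n -> T -> R) : (forall j, bmm (f j)) ->
  bmm (fun w => \sum_(j < n) f j w).
Proof.
elim: n f => [f _|n ih f mf].
  by under eq_fun do rewrite big_ord0; exact: bmm_cst.
under eq_fun do rewrite big_ord_recr.
by apply: bmmD => //; exact: ih.
Qed.

Lemma bmm_integrable (f : T -> R) (N : set T) : measurable N -> measurable_fun (~` N) f ->
  (exists C, forall w, `|f w| <= C) ->
  mu.-integrable setT (EFin \o (f \_ (~` N))).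
Proof.
move=> mN mf [C fC].
have mg : measurable_fun setT (f \_ (~` N)).
  by apply/(measurable_restrictT _ _).1 => //; exact: measurableC.
apply: measurable_bounded_integrable => //.
  by rewrite (le_lt_trans (probability_le1 _ _))// ltry.
exists C; split; first exact: num_real.
move=> x Cx w _ /=; rewrite patchE; case: ifPn => _; first by rewrite (le_trans (fC w))// ltW.
rewrite normr0 ltW// (le_lt_trans _ Cx)// (le_trans _ (fC w))//.
Qed.

Lemma ae_RintegralE (f g : T -> R) : (\forall w \ae mu, f w = g w) ->
  \int[mu]_w f w = \int[mu]_w g w.
Proof.
move=> fg; congr fine; apply: ae_integralE.
by apply: filterS fg => w -> .
Qed.

Lemma RintegralN (f : T -> R) (N : set T) : measurable N -> mu N = 0%E ->
  \int[mu]_w f w = \int[mu]_w (f \_ (~` N)) w.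
Proof.
move=> mN N0; apply: ae_RintegralE; exists N; split => // w fw.
by apply: contrapT => Nw; apply: fw; rewrite /= /patch mem_set.
Qed.

Lemma bmm_common2 f g : bmm f -> bmm g -> forall P : T -> Prop,
  (\forall w \ae mu, P w) -> exists N,
  [/\ measurable N, mu N = 0%E,
      mu.-integrable setT (EFin \o (f \_ (~` N))),
      mu.-integrable setT (EFin \o (g \_ (~` N))) &
      forall w, ~ N w -> P w].
Proof.
move=> [mf bf] [mg bg] P aeP.
have [|N [mN N0 mNf PN]] := @mu_measurable_common bool
   (fun b : bool => if b then f else g) P _ aeP; first by case.
by exists N; split => //; apply: bmm_integrable => //;
  [exact: (mNf true)|exact: (mNf false)].
Qed.

Lemma ae_le_Rintegral f g : bmm f -> bmm g -> (\forall w \ae mu, f w <= g w) ->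
  \int[mu]_w f w <= \int[mu]_w g w.
Proof.
move=> bf bg /(bmm_common2 bf bg)[N [mN N0 jf jg fg]].
rewrite (RintegralN f mN)// (RintegralN g mN)//.
apply: le_Rintegral => // w _; rewrite !patchE; case: ifPn => // /set_mem Nw.
exact: fg.
Qed.

Lemma bmm_RintegralD f g : bmm f -> bmm g ->
  \int[mu]_w (f w + g w) = \int[mu]_w f w + \int[mu]_w g w.
Proof.
move=> bf bg.
have [N [mN N0 jf jg _]] := bmm_common2 bf bg (aeW mu (fun w => I : True)).
rewrite (RintegralN f mN)// (RintegralN g mN)// (RintegralN _ mN)//.
rewrite -RintegralD//; apply: eq_Rintegral => w _.
by rewrite !patchE; case: ifPn; rewrite ?addr0.
Qed.

Lemma bmm_RintegralZ r f : bmm f ->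
  \int[mu]_w (r * f w) = r * \int[mu]_w f w.
Proof.
move=> bf.
have [N [mN N0 jf _ _]] := bmm_common2 bf bf (aeW mu (fun w => I : True)).
rewrite (RintegralN f mN)// (RintegralN _ mN)//.
rewrite -RintegralZl//; apply: eq_Rintegral => w _.
by rewrite !patchE; case: ifPn; rewrite ?mulr0.
Qed.

Lemma bmm_RintegralB f g : bmm f -> bmm g ->
  \int[mu]_w (f w - g w) = \int[mu]_w f w - \int[mu]_w g w.
Proof.
move=> bf bg; rewrite -[X in _ = _ + X]mulN1r -bmm_RintegralZ// -bmm_RintegralD//.
  by apply: eq_Rintegral => w _; rewrite mulN1r.
exact: bmmM (bmm_cst _) bg.
Qed.

Lemma Rintegral_prob_cst (r : R) : \int[mu]_w (fun=> r) w = r.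
Proof.
rewrite Rintegral_cst// [X in fine X](_ : _ = 1%E) ?mulr1//.
exact: probability_setT.
Qed.

Lemma bmm_Rintegral_sum n (f : 'I_n -> T -> R) : (forall j, bmm (f j)) ->
  \int[mu]_w (\sum_(j < n) f j w) = \sum_(j < n) \int[mu]_w f j w.
Proof.
elim: n f => [f _|n ih f bf].
  under eq_Rintegral do rewrite big_ord0.
  by rewrite big_ord0 (Rintegral_prob_cst 0).
under eq_Rintegral do rewrite big_ord_recr/=.
rewrite bmm_RintegralD//; last by apply: bmm_sum.
by rewrite big_ord_recr/= ih.
Qed.

Lemma bmm_Rintegral_norm f : bmm f ->
  `|\int[mu]_w f w| <= \int[mu]_w `|f w|.
Proof.
move=> bf; rewrite ler_norml; apply/andP; split.
  rewrite lerNl -mulN1r -bmm_RintegralZ//.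
  apply: ae_le_Rintegral; [exact: bmmM (bmm_cst _) bf|exact: bmm_norm|].
  by apply: aeW => w; rewrite mulN1r -normrN ler_norm.
apply: ae_le_Rintegral => //; first exact: bmm_norm.
by apply: aeW => w; rewrite ler_norm.
Qed.

Lemma bmm_Rintegral_eq0 f : bmm f -> (forall w, 0 <= f w) ->
  \int[mu]_w f w = 0 -> \forall w \ae mu, f w = 0.
Proof.
move=> bf f0.
have [N [mN N0 jf _ _]] := bmm_common2 bf bf (aeW mu (fun w => I : True)).
rewrite (RintegralN f mN)//; set g := f \_ _ => g0.
have g_ge0 w : (0 <= (g w)%:E)%E.
  by rewrite lee_fin /g patchE; case: ifP.
have : (\int[mu]_w `|(g w)%:E| = 0)%E.
  under eq_integral do rewrite gee0_abs//.
  rewrite -[LHS]fineK; first by rewrite -/(Rintegral mu setT g) g0.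
  exact: integrable_fin_num.
move/(ae_eq_integral_abs mu measurableT (measurable_int _ jf)).
have aeN : \forall w \ae mu, ~ N w.
  by exists N; split => // w /= /contrapT.
by apply: filterS2 aeN => w Nw /(_ I)/=[]; rewrite /g patchE mem_set.
Qed.

Lemma modulus_Rintegral delta f g : continuity_modulus delta -> bmm f -> bmm g ->
  (forall w, 0 <= f w) -> (\forall w \ae mu, delta (f w) <= g w) ->
  delta (\int[mu]_w f w) <= \int[mu]_w g w.
Proof.
move=> dP bf bg f0 dfg.
have I0 : 0 <= \int[mu]_w f w by exact: Rintegral_ge0.
have := I0; rewrite le_eqVlt => /predU1P[<-|Igt0].
  rewrite modulus0// -(Rintegral_prob_cst 0).
  apply: ae_le_Rintegral => //; first exact: bmm_cst.
  by apply: filterS dfg => w; apply: le_trans; exact: modulus_ge0.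
have [s sP] := modulus_support dP Igt0.
set m := \int[mu]_w f w in I0 Igt0 sP *.
have -> : delta m = \int[mu]_w (delta m + s * (f w - m)).
  have b1 : bmm (fun w => f w - m) by exact: bmmB bf (bmm_cst m).
  rewrite bmm_RintegralD ?bmm_RintegralZ ?bmm_RintegralB//.
  - by rewrite !Rintegral_prob_cst subrr mulr0 addr0.
  - exact: bmm_cst.
  - exact: bmm_cst.
  - exact: bmmM (bmm_cst _) b1.
apply: ae_le_Rintegral => //.
  apply: bmmD (bmm_cst _) _; apply: bmmM (bmm_cst _) _.
  exact: bmmB bf (bmm_cst m).
by apply: filterS dfg => w; apply: le_trans; exact: sP.
Qed.

End mu_measurable_theory.

Section field_theory.
Variables (R : realType) (L : signature R) (d : measure_display).
Variables (T : measurableType d) (mu : probability T R).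
Variables (M : T -> structure L) (I : Type) (e : I -> forall w, M w).
Hypothesis mf : measurable_field mu e.
Local Notation mm := (mu_measurable mu).
Local Notation gen I0 w := (@generated R L d T M I e I0 w).

Lemma fun_interp_unif (F : fun_sym L) eps : 0 < eps ->
  exists2 del : R, 0 < del & forall (N : structure L) (u v : 'I_(fun_arity F) -> N),
    sum_dist u v < del -> mdist (fun_interp N F u) (fun_interp N F v) < eps.
Proof.
move=> e0; have dP := fun_modulusP F.
exists (fun_modulus F eps); first exact: modulus_gt0.
move=> N u v uv; apply: (modulus_lt dP) => //.
exact: le_lt_trans (fun_interp_modulus _ _) uv.
Qed.

Lemma pred_interp_unif (P : pred_sym L) eps : 0 < eps ->
  exists2 del : R, 0 < del & forall (N : structure L) (u v : 'I_(pred_arity P) -> N),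
    sum_dist u v < del -> `|pred_interp N P u - pred_interp N P v| < eps.
Proof.
move=> e0; have dP := pred_modulusP P.
exists (pred_modulus P eps); first exact: modulus_gt0.
move=> N u v uv; apply: (modulus_lt dP) => //.
exact: le_lt_trans (pred_interp_modulus _ _) uv.
Qed.

Lemma closure_mdist (X : metricType R) (A : set X) x :
  closure A x <-> forall eps, 0 < eps -> exists2 y, A y & mdist x y < eps.
Proof.
split=> [Ax eps e0|Ax B /nbhs_ballP[eps /= e0 eB]].
  have [|y [Ay]] := Ax (ball x eps); first exact: nbhsx_ballx.
  by rewrite ballEmdist; exists y.
by have [y Ay xy] := Ax _ e0; exists y; split => //; apply: eB; rewrite ballEmdist.
Qed.

Lemma generated_range (g : nat -> I) w x :
  gen (range g) w x <-> forall eps, 0 < eps -> exists k, mdist x (e (g k) w) < eps.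
Proof.
split=> [/closure_mdist Ax eps /Ax[_ [_ [k _ <-] <-]]|Ax]; first by exists k.
apply/closure_mdist => eps /Ax[k xk]; exists (e (g k) w) => //.
by exists (g k) => //; exists k.
Qed.

Lemma ae_forall (K : countType) (P : K -> T -> Prop) :
  (forall k, \forall w \ae mu, P k w) -> \forall w \ae mu, forall k, P k w.
Proof.
move=> aeP; have : \forall w \ae mu, forall n : nat,
    (if unpickle n is Some k then P k else fun=> True) w.
  apply: ae_foralln => n; case: unpickle => [k|]; [exact: aeP|exact: aeW].
by apply: filterS => w Pw k; have := Pw (pickle k); rewrite pickleK.
Qed.

Lemma mu_measurable_comp n (G : forall w, ('I_n -> M w) -> R) (g : nat -> I)
    (s : 'I_n -> forall w, M w) :
  (forall eps, 0 < eps -> exists2 del, 0 < del & forall w (u v : 'I_n -> M w),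
     sum_dist u v < del -> `|G w u - G w v| < eps) ->
  (forall k : 'I_n -> nat, mm (fun w => G w (fun j => e (g (k j)) w))) ->
  (forall j, \forall w \ae mu, gen (range g) w (s j w)) ->
  (forall j k, mm (fun w => mdist (s j w) (e (g k) w))) ->
  mm (fun w => G w (fun j => s j w)).
Proof.
move=> uG mG sg ms.
pose K := ({ffun 'I_n -> nat} + 'I_n * nat)%type.
pose h (x : K) w := match x with
  | inl k => G w (fun j => e (g (k j)) w)
  | inr jk => mdist (s jk.1 w) (e (g jk.2) w) end.
have mh x : mm (h x) by case: x => [k|[j k]]; [exact: mG|exact: ms].
have [N [mN N0 mNh PN]] := mu_measurable_common mh (ae_forall sg).
apply/mu_measurableP; exists N; split => //.
pose eps m : R := m.+1%:R^-1.
have eps0 m : 0 < eps m by rewrite invr_gt0 ltr0n.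
have /choice[del delP] m : exists del, 0 < del /\ forall w (u v : 'I_n -> M w),
    sum_dist u v < del -> `|G w u - G w v| < eps m.
  by have [del d0 dP] := uG _ (eps0 m); exists del.
have mD := measurableC mN.
move=> _; apply: (measurability _ (RGenInftyO.measurableE R)) => //.
move=> _ [_ [r ->] <-].
rewrite (_ : _ `&` _ = \bigcup_(x : nat * {ffun 'I_n -> nat})
  ((~` N `&` (fun w => \sum_(j < n) h (inr (j, x.2 j)) w) @^-1` `]-oo, del x.1[) `&`
   (~` N `&` (h (inl x.2)) @^-1` `]-oo, r - eps x.1[))); last first.
  apply/seteqP; split => [w [Nw /=]|w [[m k] _ [[Nw /=]]]]; rewrite !in_itv/=.
  - move=> Gr; set a := G w _ in Gr.
    have [m /= mr] : exists m, eps m + eps m < r - a.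
      have r0 : 0 < (r - a) / 2 by rewrite divr_gt0// subr_gt0.
      have [m _ mP] := near_infty_natSinv_lt (PosNum r0).
      have mP' : eps m < (r - a) / 2 := mP m (leqnn m).
      by exists m; move: (eps m) mP' => em ?; lra.
    have [del0 delm] := delP m.
    have d0 : 0 < del m / n.+1%:R by rewrite divr_gt0.
    have /choice[k kP] j : exists k, mdist (s j w) (e (g k) w) < del m / n.+1%:R.
      by have /generated_range := PN _ Nw j; exact.
    have sk : sum_dist (fun j => s j w) (fun j => e (g (k j)) w) < del m.
      rewrite /sum_dist.
      apply: (@le_lt_trans _ _ (\sum_(j < n) del m / n.+1%:R)).
        by apply: ler_sum => j _; exact: ltW.
      rewrite sumr_const card_ord -[_ *+ n]mulr_natr mulrAC ltr_pdivrMr//.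
      by rewrite ltr_pM2l// ltr_nat.
    exists (m, [ffun j => k j]) => //; split; split => //=; rewrite in_itv/=.
      apply: le_lt_trans sk; rewrite le_eqVlt; apply/orP; left; apply/eqP.
      by apply: eq_bigr => j _; rewrite ffunE.
    have -> : (fun j : 'I_n => e (g ([ffun j0 => k j0] j)) w) =
              (fun j => e (g (k j)) w).
      by apply/funext => j; rewrite ffunE.
    have := delm _ _ _ sk; rewrite -/a ltr_norml => /andP[? ?]; lra.
  - move=> sk [_ Gr]; split => //.
    have [del0 delm] := delP m.
    have := delm w (fun j => s j w) (fun j => e (g (k j)) w) sk.
    rewrite ltr_norml => /andP[? ?]; lra.
apply: countable_bigcupT_measurable; first exact: countableP.
move=> [m k]; apply: measurableI.
- have mS : measurable_fun (~` N) (fun w => \sum_(j < n) h (inr (j, k j)) w).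
    by apply: measurable_sum => j; exact: mNh.
  by apply: mS => //; exact: measurable_itv.
- by apply: mNh => //; exact: measurable_itv.
Qed.

Lemma countable_range (I0 : set I) : countable I0 -> I0 !=set0 ->
  exists g : nat -> I, range g = I0.
Proof.
move=> /pfcard_geP[-> []//|[g] _]; exists g.
have [/= gS gf] := (@funS _ _ _ _ g, @surj _ _ _ _ g).
by apply/seteqP; split => [_ [k _ <-]|i /gf[k _ <-]]; [exact: gS|exists k].
Qed.

Lemma measurable_section_range f : measurable_section mu e f -> exists g : nat -> I,
  (\forall w \ae mu, gen (range g) w (f w)) /\
  (forall k, mm (fun w => mdist (f w) (e (g k) w))).
Proof.
move=> [I0 [cI0 fI0 mfI0]].
have /(countable_range cI0)[g gI0] : I0 !=set0.
  apply/set0P/eqP => I00.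
  have [N [mN N0 fN]] := null_set_of fI0.
  have NT w : N w.
    apply: contrapT => /fN; rewrite I00 /generated image_set0 closure0.
    by [].
  have : mu setT = 0%E by rewrite -N0; congr (mu _); apply/seteqP; split.
  by rewrite probability_setT => /eqP; rewrite onee_eq0.
exists g; rewrite gI0; split => // k; apply: mfI0; rewrite -gI0.
by exists k.
Qed.

Lemma field_mdist i i' : mm (fun w => mdist (e i w) (e i' w)).
Proof.
have := field_pred mf (P := None) (fun j : 'I_2 => if j == ord0 then i else i').
by under [X in mu_measurable _ X -> _]eq_fun do rewrite pred_interp_dist.
Qed.

Lemma mdistB (X : metricType R) (x y z : X) : `|mdist x z - mdist y z| <= mdist x y.
Proof.
have h1 := metric_triangle x y z; have h2 := metric_triangle y x z.
rewrite (metric_sym y x) in h2.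
by rewrite ler_norml; apply/andP; split; lra.
Qed.

Lemma section_mdist f i : measurable_section mu e f ->
  mm (fun w => mdist (f w) (e i w)).
Proof.
move=> /measurable_section_range[g [fg mfg]].
apply: (@mu_measurable_comp 1 (fun w v => mdist (v ord0) (e i w)) g (fun=> f)) => //.
- move=> eps e0; exists eps => // w u v.
  by rewrite /sum_dist big_ord1; apply: le_lt_trans; exact: mdistB.
- by move=> k; exact: field_mdist.
Qed.

Lemma common_range (K : countType) (s : K -> forall w, M w) F0 P0 :
  finite_set F0 -> finite_set P0 ->
  (forall j, measurable_section mu e (s j)) -> exists g : nat -> I,
  (forall j, \forall w \ae mu, gen (range g) w (s j w)) /\
  (\forall w \ae mu, affine_substructure F0 P0 (gen (range g) w)).
Proof.
move=> fF fP ms.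
have /choice[J JP] j : exists J : set I, countable J /\
    \forall w \ae mu, gen J w (s j w).
  by have [J [cJ sJ _]] := ms j; exists J.
have cJ : countable (\bigcup_j J j).
  by apply: bigcup_countable => [|j _]; [exact: countableP|case: (JP j)].
have [I0 [cI0 JI0 aeI0]] := field_cofinal mf fF fP cJ.
have /(countable_range cI0)[g gI0] : I0 !=set0.
  apply/set0P/eqP => I00.
  have [N [mN N0 fN]] := null_set_of aeI0.
  have NT w : N w.
    apply: contrapT => /fN; rewrite I00 /generated image_set0 closure0.
    by case=> -[].
  have : mu setT = 0%E by rewrite -N0; congr (mu _); apply/seteqP; split.
  by rewrite probability_setT => /eqP; rewrite onee_eq0.
exists g; rewrite gI0; split => // j.
have [_] := JP j; apply: filterS => w; apply: closureS => _ [i Ji <-].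
by exists i => //; apply: JI0; exists j.
Qed.

Lemma pred_section (P : pred_sym L) (s : 'I_(pred_arity P) -> forall w, M w) :
  (forall j, measurable_section mu e (s j)) ->
  mm (fun w => pred_interp (M w) P (fun j => s j w)).
Proof.
move=> ms; have [g [sg _]] := common_range (finite_set0 _) (finite_set0 _) ms.
apply: (@mu_measurable_comp _ (fun w v => pred_interp (M w) P v) g s) => //.
- move=> eps /(pred_interp_unif P)[del d0 dP]; exists del => // w; exact: dP.
- by move=> k; exact: (field_pred mf).
- by move=> j k; exact: section_mdist.
Qed.

Lemma fun_section (F : fun_sym L) (s : 'I_(fun_arity F) -> forall w, M w) :
  (forall j, measurable_section mu e (s j)) ->
  measurable_section mu e (fun w => fun_interp (M w) F (fun j => s j w)).
Proof.
move=> ms; have [g [sg asg]] := common_range (finite_set1 F) (finite_set0 _) ms.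
exists (range g); split.
- exact: card_image_le.
- apply: filterS2 asg (ae_forall sg) => w [_ clF _] sw.
  by apply: clF => // j; exact: sw.
- move=> i _.
  apply: (@mu_measurable_comp _ (fun w v => mdist (fun_interp (M w) F v) (e i w)) g s) => //.
  + move=> eps /(fun_interp_unif F)[del d0 dP]; exists del => // w u v uv.
    exact: le_lt_trans (mdistB _ _ _) (dP _ _ _ uv).
  + by move=> k; exact: (field_fun mf).
  + by move=> j k; exact: section_mdist.
Qed.

Lemma limit_section (s : nat -> forall w, M w) f :
  (forall k, measurable_section mu e (s k)) ->
  (\forall w \ae mu, s ^~ w @ \oo --> f w) -> measurable_section mu e f.
Proof.
move=> ms sf; have [g [sg _]] := common_range (finite_set0 _) (finite_set0 _) ms.
exists (range g); split.
- exact: card_image_le.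
- apply: filterS2 sf (ae_forall sg) => w sfw sw; apply/closure_mdist => eps e0.
  have e20 : 0 < eps / 2 by rewrite divr_gt0.
  have [k _ /(_ k (leqnn k)) /= sk] := metricType_numDomainType.cvgr_dist_lt sfw e20.
  have /closure_mdist/(_ _ e20)[y gy yk] := sw k; exists y => //.
  by have := metric_triangle (f w) (s k w) y; lra.
- move=> i _.
  have [N [mN N0 mNs PN]] :=
    mu_measurable_common (fun k => section_mdist i (ms k)) sf.
  apply/mu_measurableP; exists N; split => //.
  apply: (measurable_fun_cvg mNs) => w Nw.
  apply/cvgrPdist_lt => eps e0.
  apply: filterS (metricType_numDomainType.cvgr_dist_lt (PN _ Nw) e0) => k fk /=.
  exact: le_lt_trans (mdistB _ _ _) fk.
Qed.

End field_theory.

Section direct_integral.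
Variables (R : realType) (L : signature R) (d : measure_display).
Variables (T : measurableType d) (mu : probability T R).
Variables (M : T -> structure L) (I : Type) (e : I -> forall w, M w).

Record msection := MSection {
  msection_fun :> forall w, M w;
  msectionP : measurable_section mu e msection_fun
}.

HB.instance Definition _ := gen_eqMixin msection.
HB.instance Definition _ := gen_choiceMixin msection.

Definition msection_ae_eq (f g : msection) : bool :=
  `[< \forall w \ae mu, f w = g w >].

Let ae_eq_refl : reflexive msection_ae_eq.
Proof. by move=> f; apply/asboolP; exact: aeW. Qed.

Let ae_eq_sym : symmetric msection_ae_eq.
Proof. by move=> f g; apply/asboolP/asboolP; apply: filterS => w ->. Qed.

Let ae_eq_trans : transitive msection_ae_eq.
Proof.
move=> g f h /asboolP fg /asboolP gh; apply/asboolP.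
by apply: filterS2 fg gh => w -> ->.
Qed.

Canonical msection_ae_eq_equiv :=
  EquivRel msection_ae_eq ae_eq_refl ae_eq_sym ae_eq_trans.

Hypothesis mf : measurable_field mu e.
Local Notation mm := (mu_measurable mu).

Local Open Scope quotient_scope.

(* The argument [mf] is only there to find the metric on the quotient. *)
Definition direct_integral_carrier of measurable_field mu e : Type :=
  {eq_quot msection_ae_eq}.
Local Notation DI := (direct_integral_carrier mf).

HB.instance Definition _ := Choice.on DI.
HB.instance Definition _ := EqQuotient.on DI.

Definition section_class (f : msection) : DI := \pi_DI f.

Lemma section_classP f g :
  section_class f = section_class g <-> \forall w \ae mu, f w = g w.
Proof.
rewrite /section_class; split=> [/eqP|fg]; first by rewrite eqmodE => /asboolP.
by apply/eqP; rewrite eqmodE; exact/asboolP.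
Qed.

Lemma repr_section_class f : \forall w \ae mu, repr (section_class f) w = f w.
Proof. by apply/section_classP; rewrite /section_class reprK. Qed.

Lemma mdist_le_hi (N : structure L) (x y : N) :
  mdist x y <= pred_hi (None : pred_sym L).
Proof.
have := @pred_interp_bounds _ _ N None (fun j : 'I_2 => if j == ord0 then x else y).
by rewrite pred_interp_dist /= => /andP[].
Qed.

Lemma bmm_mdist (f g : msection) : bmm mu (fun w => mdist (f w) (g w)).
Proof.
split; last first.
  exists (pred_hi (None : pred_sym L)) => w.
  by rewrite ger0_norm ?mdist_ge0// mdist_le_hi.
have ms (j : 'I_2) : measurable_section mu e (if j == ord0 then f else g).
  by case: ifP => _; exact: msectionP.
have := pred_section mf (P := None) ms.
by under [X in mu_measurable _ X -> _]eq_fun do rewrite pred_interp_dist.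
Qed.

Lemma bmm_pred (P : pred_sym L) (s : 'I_(pred_arity P) -> msection) :
  bmm mu (fun w => pred_interp (M w) P (fun j => s j w)).
Proof.
split; first by apply: (pred_section mf (s := s)) => j; exact: msectionP.
exists (`|pred_lo P| + `|pred_hi P|) => w.
have /andP[h1 h2] := pred_interp_bounds (fun j => s j w).
rewrite ler_norml; apply/andP; split.
  have := ler_norm (- pred_lo P); rewrite normrN => ?.
  by have := normr_ge0 (pred_hi P); lra.
by have := ler_norm (pred_hi P); have := normr_ge0 (pred_lo P); lra.
Qed.

Definition direct_integral_dist (p q : DI) : R :=
  \int[mu]_w mdist (repr p w) (repr q w).

Lemma direct_integral_distE f g :
  direct_integral_dist (section_class f) (section_class g) =
  \int[mu]_w mdist (f w) (g w).
Proof.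
apply: ae_RintegralE.
by apply: filterS2 (repr_section_class f) (repr_section_class g) => w -> ->.
Qed.

Let distxx p : direct_integral_dist p p = 0.
Proof.
rewrite /direct_integral_dist.
under eq_Rintegral do rewrite mdistxx.
exact: (Rintegral_prob_cst mu 0).
Qed.

Let dist_positivity p q : direct_integral_dist p q = 0 -> p = q.
Proof.
move/(bmm_Rintegral_eq0 (bmm_mdist _ _) (fun w => mdist_ge0 _ _)) => pq.
rewrite -[p]reprK -[q]reprK; apply/section_classP.
by apply: filterS pq => w /mdist_positivity.
Qed.

Let dist_sym p q : direct_integral_dist p q = direct_integral_dist q p.
Proof. by apply: eq_Rintegral => w _; rewrite metric_sym. Qed.

Let dist_triangle q p r :
  direct_integral_dist p r <= direct_integral_dist p q + direct_integral_dist q r.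
Proof.
rewrite -bmm_RintegralD; [|exact: bmm_mdist..].
apply: ae_le_Rintegral; [exact: bmm_mdist|by apply: bmmD; exact: bmm_mdist|].
by apply: aeW => w; exact: metric_triangle.
Qed.

HB.instance Definition _ :=
  isMetric.Build R DI distxx dist_positivity dist_sym dist_triangle.

Lemma mdist_direct_integral (p q : DI) :
  mdist p q = \int[mu]_w mdist (repr p w) (repr q w).
Proof. by []. Qed.

Lemma mdist_section_class f g : mdist (section_class f) (section_class g) =
  \int[mu]_w mdist (f w) (g w).
Proof. exact: direct_integral_distE. Qed.

Definition msection_app (F : fun_sym L) (s : 'I_(fun_arity F) -> msection) : msection :=
  MSection (fun_section mf (fun j => msectionP (s j))).

Definition direct_integral_fun (F : fun_sym L) (v : 'I_(fun_arity F) -> DI) : DI :=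
  section_class (msection_app (fun j => repr (v j))).

Definition direct_integral_pred (P : pred_sym L) (v : 'I_(pred_arity P) -> DI) : R :=
  \int[mu]_w pred_interp (M w) P (fun j => repr (v j) w).

Lemma direct_integral_nonempty : exists x : DI, True.
Proof.
have [s _] := @common_range _ _ _ _ _ _ _ _ mf void (fun x : void => match x with end)
  set0 set0 (finite_set0 _) (finite_set0 _) (fun x : void => match x with end).
have fP : measurable_section mu e (e (s 0%N)).
  exists [set s 0%N]; split => //.
    by apply: aeW => w; apply: subset_closure; exists (s 0%N).
  by move=> i _; exact: field_mdist.
by exists (section_class (MSection fP)).
Qed.

Lemma direct_integral_pred_dist (v : 'I_2 -> DI) :
  direct_integral_pred (P := None) v = mdist (v ord0) (v ord_max).
Proof. by apply: eq_Rintegral => w _; rewrite pred_interp_dist. Qed.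

Lemma direct_integral_pred_bounds (P : pred_sym L) (v : 'I_(pred_arity P) -> DI) :
  pred_lo P <= direct_integral_pred v <= pred_hi P.
Proof.
rewrite -{1}(Rintegral_prob_cst mu (pred_lo P)) -(Rintegral_prob_cst mu (pred_hi P)).
apply/andP; split; apply: ae_le_Rintegral;
  do ?[exact: bmm_cst|exact: bmm_pred];
  by apply: aeW => w; have /andP[] := pred_interp_bounds (fun j => repr (v j) w).
Qed.

Lemma sum_dist_direct_integral n (u v : 'I_n -> DI) :
  sum_dist u v = \int[mu]_w sum_dist (fun j => repr (u j) w) (fun j => repr (v j) w).
Proof.
by rewrite [RHS]bmm_Rintegral_sum// => j; exact: bmm_mdist.
Qed.

Let bmm_sum_dist n (u v : 'I_n -> DI) :
  bmm mu (fun w => sum_dist (fun j => repr (u j) w) (fun j => repr (v j) w)).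
Proof. by apply: bmm_sum => j; exact: bmm_mdist. Qed.

Lemma direct_integral_fun_modulus (F : fun_sym L) (u v : 'I_(fun_arity F) -> DI) :
  fun_modulus F (mdist (direct_integral_fun u) (direct_integral_fun v)) <=
  sum_dist u v.
Proof.
rewrite mdist_section_class sum_dist_direct_integral.
apply: modulus_Rintegral; [exact: fun_modulusP|exact: bmm_mdist|exact: bmm_sum_dist|..].
  by move=> w; exact: mdist_ge0.
by apply: aeW => w; exact: fun_interp_modulus.
Qed.

Lemma direct_integral_pred_modulus (P : pred_sym L) (u v : 'I_(pred_arity P) -> DI) :
  pred_modulus P `|direct_integral_pred u - direct_integral_pred v| <= sum_dist u v.
Proof.
have bu := bmm_pred (fun j => repr (u j)); have bv := bmm_pred (fun j => repr (v j)).
rewrite sum_dist_direct_integral -bmm_RintegralB//.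
have dP := pred_modulusP P; have bB := bmmB bu bv.
apply: (@le_trans _ _ (pred_modulus P (\int[mu]_w
  `|pred_interp (M w) P (fun j => repr (u j) w) -
    pred_interp (M w) P (fun j => repr (v j) w)|))).
  by apply: (modulus_mono dP) => //; exact: bmm_Rintegral_norm.
apply: modulus_Rintegral => //; first exact: bmm_norm.
by apply: aeW => w; exact: pred_interp_modulus.
Qed.

Lemma cauchy_mdist (X : metricType R) (u : nat -> X) : cauchy (u @ \oo) <->
  forall eps, 0 < eps -> exists N, forall n m, (N <= n)%N -> (N <= m)%N ->
    mdist (u n) (u m) < eps.
Proof.
split=> [/cauchy_ballP cu eps /cu [[A B] [/= [N1 _ AN] [N2 _ BN]] AB]|cu].
  exists (maxn N1 N2) => n m; rewrite !geq_max => /andP[n1 _] /andP[_ m2].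
  have := AB (u n, u m); rewrite /= ballEmdist; apply; split => /=.
    exact: AN.
  exact: BN.
apply/cauchy_ballP => eps /cu[N NP].
exists (u @` [set n | (N <= n)%N], u @` [set n | (N <= n)%N]) => /=.
  by split; exists N => // n /= Nn; exists n.
by move=> [_ _] [/= [n Nn <-] [m Nm <-]]; rewrite ballEmdist; exact: NP.
Qed.

Lemma cauchy_summable (X : metricType R) (u : nat -> X) (C : R) :
  (forall n, \sum_(0 <= k < n) mdist (u k) (u k.+1) <= C) -> cauchy (u @ \oo).
Proof.
move=> uC; pose S n := \sum_(0 <= k < n) mdist (u k) (u k.+1).
have ndS : nondecreasing_seq S.
  apply/nondecreasing_seqP => n; rewrite /S big_nat_recr//= lerDl.
  exact: mdist_ge0.
have cS : cvgn S.
  apply: nondecreasing_is_cvgn => //.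
  by exists C => _ [n _ <-]; exact: uC.
have uS n m : (n <= m)%N -> mdist (u n) (u m) <= S m - S n.
  move=> /subnK <-; elim: (m - n)%N => [|k ih].
    by rewrite add0n mdistxx subrr.
  rewrite addSn (le_trans (metric_triangle _ (u (k + n)%N) _))//.
  by rewrite {1}/S big_nat_recr//= addrAC lerD2r.
apply/cauchy_mdist => eps e0.
have e20 : 0 < eps / 2 by rewrite divr_gt0.
have [N _ NP] := (cvgrPdist_lt _ _).1 cS _ e20.
have main n m : (N <= n)%N -> (n <= m)%N -> mdist (u n) (u m) < eps.
  move=> Nn nm; have /= := NP n Nn; have /= := NP m (leq_trans Nn nm).
  rewrite !ltr_norml => /andP[? ?] /andP[? ?].
  by have := uS _ _ nm; lra.
exists N => n m Nn Nm; have [nm|/ltnW mn] := leqP n m; first exact: main.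
by rewrite metric_sym; exact: main.
Qed.

Lemma direct_integral_complete (u : nat -> DI) :
  cauchy (u @ \oo) -> exists x : DI, u @ \oo --> x.
Proof.
move=> /cauchy_mdist cu.
have /choice[N NP] k : exists N, forall n m, (N <= n)%N -> (N <= m)%N ->
    mdist (u n) (u m) < (1 / 2) ^+ k.
  by apply: cu; rewrite exprn_gt0// divr_gt0.
pose phi k := (\sum_(0 <= i < k.+1) (N i).+1)%N.
have phiS k : (phi k <= phi k.+1)%N.
  by rewrite /phi [leqRHS]big_nat_recr//= leq_addr.
have Nphi k : (N k <= phi k)%N.
  by rewrite /phi big_nat_recr//= (leq_trans (leqnSn _))// leq_addl.
have kphi k : (k <= phi k)%N.
  elim: k => // k ih; rewrite /phi big_nat_recr//= -/(phi k) addnS ltnS.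
  by rewrite (leq_trans ih)// leq_addr.
pose s k := repr (u (phi k)).
pose h k w := mdist (s k w) (s k.+1 w).
have bh k : bmm mu (h k) by exact: bmm_mdist.
have hk k : \int[mu]_w h k w < (1 / 2) ^+ k.
  by apply: NP => //; rewrite (leq_trans (Nphi k)).
have [N0 [mN0 N00 mh _]] :=
  mu_measurable_common (fun k => (bh k).1) (aeW mu (fun w => Logic.I)).
have ih k := bmm_integrable mu mN0 (mh k) (bh k).2.
pose g k : T -> \bar R := EFin \o (h k \_ (~` N0)).
have g0 k w : (0 <= g k w)%E.
  by rewrite lee_fin patchE; case: ifP => // _; exact: mdist_ge0.
have mg k : measurable_fun setT (g k) by have /integrableP[] := ih k.
have sumg : (\int[mu]_w (\sum_(0 <= k <oo) g k w) < +oo)%E.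
  rewrite integral_nneseries//.
  apply: (@le_lt_trans _ _ (\sum_(0 <= k <oo) (((1 / 2) ^+ k)%:E : \bar R))%E).
    apply: lee_nneseries => [k _ _|k _]; first by apply: integral_ge0 => w _; exact: g0.
    rewrite -[leLHS]fineK; last exact: (integrable_fin_num measurableT (ih k)).
    have := hk k; rewrite (RintegralN _ mN0 N00) lee_fin.
    exact: ltW.
  rewrite (_ : (fun n => _) = EFin \o series (geometric 1 (1 / 2))); last first.
    apply/funext => n; rewrite /series/= -sumEFin; apply: eq_bigr => i _.
    by rewrite !mul1r.
  have h2 : `|1 / 2 : R| < 1.
    by rewrite ger0_norm ?divr_ge0// ltr_pdivrMr// mul1r ltr1n.
  have cg : (EFin \o series (geometric (1 : R) (1 / 2))) @ \oo -->
      (1 / (1 - 1 / 2))%:E.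
    by apply: cvg_EFin; [exact: nearW|exact: cvg_geometric_series].
  by rewrite (cvg_lim _ cg)//; exact: ltry.
have ig : mu.-integrable setT (fun w => (\sum_(0 <= k <oo) g k w)%E).
  apply/integrableP; split.
    by apply: ge0_emeasurable_sum.
  under eq_integral do rewrite gee0_abs ?nneseries_ge0//.
  exact: sumg.
have aeN0 : \forall w \ae mu, ~ N0 w.
  by exists N0; split => // w /= /contrapT.
have scvg : \forall w \ae mu, exists x : M w, s ^~ w @ \oo --> x.
  apply: filterS2 aeN0 (integrable_ae measurableT ig) => w Nw /(_ Logic.I) fw.
  apply: structure_complete.
  apply: (@cauchy_summable _ _ (fine (\sum_(0 <= k <oo) g k w)%E)) => n.
  rewrite -lee_fin fineK// -sumEFin.
  apply: le_trans (nneseries_lim_ge n _) => //.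
  by apply: lee_sum => k _; rewrite /g /= patchE mem_set.
pose f w : M w := if pselect (exists x : M w, s ^~ w @ \oo --> x) is left h'
  then sval (cid h') else s 0%N w.
have sf : \forall w \ae mu, s ^~ w @ \oo --> f w.
  by apply: filterS scvg => w hw; rewrite /f; case: pselect => // h'; case: cid.
pose F := MSection (limit_section mf (fun k => msectionP (s k)) sf).
exists (section_class F).
have bF k := bmm_mdist (s k) F.
have [N1 [mN1 N10 mF sfN]] := mu_measurable_common (fun k => (bF k).1) sf.
pose C := pred_hi (None : pred_sym L).
have C0 : 0 <= C.
  have [w _] : [set: T] !=set0.
    apply/set0P/eqP => T0; have := @probability_setT _ _ _ mu.
    by rewrite T0 measure0 => /esym/eqP; rewrite onee_eq0.
  by apply: le_trans (mdist_le_hi (s 0%N w) (s 0%N w)); exact: mdist_ge0.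
have lim0 : (\int[mu]_w mdist (s k w) (F w)) @[k --> \oo] --> (0 : R).
  have := @dominated_cvg _ T R mu setT measurableT
    (fun k => EFin \o ((fun w => mdist (s k w) (F w)) \_ (~` N1))) (cst 0%E) (cst C%:E).
  rewrite integral0 => dom.
  have /fine_cvg : (\int[mu]_w ((EFin \o ((fun w => mdist (s k w) (F w)) \_ (~` N1))) w)%E
      @[k --> \oo] --> 0%:E)%E.
    apply: dom => //.
    - by move=> k; have /integrableP[] := bmm_integrable mu mN1 (mF k) (bF k).2.
    - move=> w _; apply: cvg_EFin; first exact: nearW.
      have [Nw|Nw] := pselect (N1 w).
        rewrite (_ : _ \o _ = cst 0); first exact: cvg_cst.
        by apply/funext => k /=; rewrite patchE memNset//; exact: notK.
      rewrite (_ : _ \o _ = fun k => mdist (s k w) (F w)); last first.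
        by apply/funext => k /=; rewrite patchE mem_set.
      apply/cvgrPdist_lt => eps e0.
      apply: filterS (metricType_numDomainType.cvgr_dist_lt (sfN _ Nw) e0) => k.
      by rewrite sub0r normrN ger0_norm ?mdist_ge0// metric_sym.
    - exact: finite_measure_integrable_cst.
    - move=> k w _ /=; rewrite lee_fin patchE; case: ifP => _.
        by rewrite ger0_norm ?mdist_ge0// mdist_le_hi.
      by rewrite normr0.
  apply: cvg_trans; apply: near_eq_cvg; near=> k => /=.
  by rewrite (RintegralN _ mN1).
apply/metricType_numDomainType.cvgrPdist_lt => eps e0.
have e20 : 0 < eps / 2 by rewrite divr_gt0.
have [K0 K0P] := cu _ e20.
have [K1 _ K1P] := (cvgrPdist_lt _ _).1 lim0 _ e20.
pose k := maxn K0 K1.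
have K0k : (K0 <= phi k)%N by rewrite (leq_trans _ (kphi k))// leq_maxl.
exists (phi k) => // n /= kn.
rewrite (le_lt_trans (metric_triangle _ (u (phi k)) _))//.
have d2 := K0P (phi k) n K0k (leq_trans K0k kn).
have d1 : mdist (section_class F) (u (phi k)) < eps / 2.
  rewrite -[u (phi k)]reprK -/(s k) metric_sym mdist_section_class.
  have := K1P k (leq_maxr _ _); rewrite /= sub0r normrN ger0_norm//.
  by apply: Rintegral_ge0 => w _; exact: mdist_ge0.
lra.
Unshelve. all: by end_near. Qed.

Definition direct_integral : structure L := {|
  carrier := DI;
  fun_interp := direct_integral_fun;
  pred_interp := direct_integral_pred;
  structure_nonempty := direct_integral_nonempty;
  structure_complete := direct_integral_complete;
  pred_interp_dist := direct_integral_pred_dist;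
  pred_interp_bounds := direct_integral_pred_bounds;
  fun_interp_modulus := direct_integral_fun_modulus;
  pred_interp_modulus := direct_integral_pred_modulus
|}.

End direct_integral.

(* Main.v *)
(** By induction on the formula. For [Sup phi], almost everywhere the supremum
    over [M w] equals the supremum over a countable family
    [e (g k)] of the enumeration, by affine elementarity of the structure which
    this family generates and by uniform continuity of [phi]; this gives
    measurability. Choosing at each [w] the least [k] for which [e (g k) w] is
    [eps]-optimal yields a measurable section which is [eps]-optimal almost
    everywhere, so the integral of the supremum is the supremum over sections. *)
Require Import Defs.
From HB Require Import structures.
From mathcomp Require Import all_boot all_order all_algebra.
From mathcomp Require Import all_classical all_reals all_analysis.
From mathcomp Require Import measurable_realfun lra.
Import Order.TTheory GRing.Theory Num.Theory.
Import numFieldNormedType.Exports.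

Set Implicit Arguments.
Unset Strict Implicit.
Unset Printing Implicit Defensive.

Local Open Scope classical_set_scope.
Local Open Scope ring_scope.

Lemma extend_comp (X Y : Type) (h : X -> Y) n (x : X) (v : 'I_n -> X) :
  (fun j => h (extend x v j)) = extend (h x) (fun j => h (v j)).
Proof. by apply/funext => j; rewrite /extend; case: unlift. Qed.

(** * Suprema of bounded families of reals *)

Section sup_family.
Variable R : realType.

Lemma sup_family_ge (X : Type) (h : X -> R) C (A : set X) x :
  (forall x, `|h x| <= C) -> A x -> h x <= sup [set h y | y in A].
Proof.
move=> hC Ax; apply: ub_le_sup; last by exists x.
by exists C => _ [y _ <-]; exact: le_trans (ler_norm _) (hC y).
Qed.

Lemma sup_family_le (X : Type) (h : X -> R) (A : set X) c :
  A !=set0 -> (forall x, A x -> h x <= c) -> sup [set h y | y in A] <= c.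
Proof.
move=> [x Ax] hc; apply: ge_sup; first by exists (h x), x.
by move=> _ [y Ay <-]; exact: hc.
Qed.

Lemma positive_lower_bound n (d : 'I_n -> R) : (forall j, 0 < d j) ->
  exists2 del, 0 < del & forall j, del <= d j.
Proof.
(* The seed [1] of the minimum keeps the bound positive when [n = 0]. *)
move=> d0; exists (\big[Order.min/1]_(j < n) d j); last first.
  by move=> j; exact: bigmin_le_cond.
by apply/bigmin_gtP; split => // j _; exact: d0.
Qed.

End sup_family.

(** * Finite subsignatures, uniform bounds and uniform continuity of formulas *)

Section syntax.
Variables (R : realType) (L : signature R).

Lemma term_overS (F0 F1 : set (fun_sym L)) n (t : term L n) :
  F0 `<=` F1 -> term_over F0 t -> term_over F1 t.
Proof. by move=> F01; elim: t => //= F a ih [F0F ta]; split; auto. Qed.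

Lemma formula_overS (F0 F1 : set (fun_sym L)) (P0 P1 : set (rel_sym L)) n
    (phi : formula L n) : F0 `<=` F1 -> P0 `<=` P1 ->
  formula_over F0 P0 phi -> formula_over F1 P1 phi.
Proof.
move=> F01 P01; elim: phi => {n} //= [n P a [Pa ta]|n phi ih psi ih' []]; last first.
  by split; auto.
split; first by case: P Pa {a ta} => //= Q; exact: P01.
by move=> j; exact: term_overS (ta j).
Qed.

Lemma term_over_finite n (t : term L n) :
  exists2 F0 : set (fun_sym L), finite_set F0 & term_over F0 t.
Proof.
elim: t => [i|F a ih]; first by exists set0.
have /choice[G GP] j : exists G : set (fun_sym L), finite_set G /\ term_over G (a j).
  by have [G fG aG] := ih j; exists G.
exists (F |` \bigcup_j G j).
  rewrite finite_setU; split; first exact: finite_set1.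
  by apply: bigcup_finite => [|j _]; [exact: finite_finset|case: (GP j)].
split; first by left.
by move=> j; apply: term_overS (GP j).2 => H GH; right; exists j.
Qed.

(** A measurable field provides elementary substructures for finite subsignatures only. A formula
    contains finitely many symbols, so it lives in one of these. *)
Lemma formula_over_finite n (phi : formula L n) :
  exists F0 P0, [/\ finite_set F0, finite_set P0 & @formula_over R L F0 P0 n phi].
Proof.
elim: phi => {n} //= [n P a|n r|n phi [F0 [P0 [fF fP phi0]]] psi [F1 [P1 [fF1 fP1 psi1]]]].
- have /choice[G GP] j : exists G : set (fun_sym L), finite_set G /\ term_over G (a j).
    by have [G fG aG] := term_over_finite (a j); exists G.
  (* The distance belongs to every subsignature, so an atom [None] contributes no predicate
     symbol. *)
  exists (\bigcup_j G j), (if P is Some Q then [set Q] else set0); split.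
  + by apply: bigcup_finite => [|j _]; [exact: finite_finset|case: (GP j)].
  + by case: P {a G GP} => [Q|]; [exact: finite_set1|exact: finite_set0].
  + split; first by case: P {a G GP}.
    by move=> j; apply: term_overS (GP j).2 => H GH; exists j.
- by exists set0, set0; split.
- exists (F0 `|` F1), (P0 `|` P1); split; rewrite ?finite_setU//.
  by split; [apply: formula_overS phi0|apply: formula_overS psi1];
    do ?[exact: subsetUl|exact: subsetUr].
Qed.

(** [del] is chosen before [N]: the moduli belong to the signature, so one estimate holds in all
    structures. *)
Definition term_unif n (t : term L n) := forall eps, 0 < eps ->
  exists2 del : R, 0 < del & forall (N : structure L) (u v : 'I_n -> N),
    sum_dist u v < del -> mdist (term_value u t) (term_value v t) < eps.

Lemma term_unif_sum_dist n m (a : 'I_m -> term L n) eps :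
  (forall j, term_unif (a j)) -> 0 < eps ->
  exists2 del : R, 0 < del & forall (N : structure L) (u v : 'I_n -> N),
    sum_dist u v < del ->
    sum_dist (fun j => term_value u (a j)) (fun j => term_value v (a j)) < eps.
Proof.
(* Dividing by [m.+1] covers [m = 0] and keeps the sum of [m] terms strictly below [eps]. *)
move=> au e0; have d1 : 0 < eps / m.+1%:R by rewrite divr_gt0.
have /choice[d dP] j : exists d, 0 < d /\ forall (N : structure L) (u v : 'I_n -> N),
    sum_dist u v < d -> mdist (term_value u (a j)) (term_value v (a j)) < eps / m.+1%:R.
  by have [d ? ?] := au j _ d1; exists d.
have [del del_gt0 del_le] := positive_lower_bound (fun j => (dP j).1).
exists del => // N u v uv.
apply: (@le_lt_trans _ _ (\sum_(j < m) eps / m.+1%:R)).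
  by apply: ler_sum => j _; apply/ltW/(dP j).2; exact: lt_le_trans (del_le j).
rewrite sumr_const card_ord -[_ *+ _]mulr_natr mulrAC ltr_pdivrMr//.
by rewrite ltr_pM2l// ltr_nat.
Qed.

Lemma term_value_unif n (t : term L n) : term_unif t.
Proof.
elim: t => [i|F a ih] eps e0.
  exists eps => // N u v; apply: le_lt_trans.
  by rewrite /sum_dist (bigD1 i)//= lerDl sumr_ge0// => j _; exact: mdist_ge0.
have [del0 d0 del0P] := fun_interp_unif F e0.
have [del del_gt0 delP] := term_unif_sum_dist ih d0.
by exists del => // N u v uv; apply/del0P/delP.
Qed.

(** The bounds come from the signature and the coefficients, so [C] serves every fibre and the
    direct integral at once. This makes the suprema genuine and the integrands bounded in [w]. *)
Lemma value_bounded n (phi : formula L n) :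
  exists C : R, forall (N : structure L) (v : 'I_n -> N), `|value N phi v| <= C.
Proof.
have bounds (N : structure L) (h : N -> R) C :
    (forall x, `|h x| <= C) -> `|sup [set h x | x in setT]| <= C.
  move=> hC; have [x _] := structure_nonempty N.
  rewrite ler_norml (le_trans _ (sup_family_ge hC (I : setT x)))/=.
    by apply: sup_family_le => [|y _]; [exists x|exact: le_trans (ler_norm _) (hC y)].
  by have := hC x; rewrite ler_norml => /andP[].
elim: phi => {n} /= [n P a|n r|n phi [C ih] psi [D ih']|n r phi [C ih]|n phi [C ih]
  |n phi [C ih]].
- exists (`|pred_lo P| + `|pred_hi P|) => N v; rewrite /value/=.
  have /andP[h1 h2] := pred_interp_bounds (fun j => term_value v (a j)).
  have := ler_norm (- pred_lo P); have := ler_norm (pred_hi P); rewrite normrN.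
  have := normr_ge0 (pred_hi P); have := normr_ge0 (pred_lo P).
  by rewrite ler_norml => ? ? ? ?; apply/andP; split; lra.
- by exists `|r|.
- by exists (C + D) => N v; rewrite (le_trans (ler_normD _ _))// lerD// ?ih ?ih'.
- by exists (`|r| * C) => N v; rewrite /value/= normrM ler_wpM2l// ih.
- by exists C => N v; rewrite /value/=; apply: bounds => x; exact: ih.
(* [inf] unfolds to the opposite of the supremum of the opposites, to which [bounds] applies. *)
- exists C => N v; rewrite /value/= /inf normrN image_comp.
  by apply: bounds => x /=; rewrite normrN; exact: ih.
Qed.

(** This leaves [Sup] as the only quantifier that needs an argument of its own. *)
Lemma value_Inf (N : structure L) n (phi : formula L n.+1) v :
  value N (Inf phi) v = -1 * value N (Sup (Scale (-1) phi)) v.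
Proof.
rewrite mulN1r /value/= /inf image_comp; congr (- sup _).
by apply: eq_imagel => x _ /=; rewrite mulN1r.
Qed.

Lemma sum_dist_extend (X : metricType R) n (x : X) (u v : 'I_n -> X) :
  sum_dist (extend x u) (extend x v) = sum_dist u v.
Proof.
rewrite /sum_dist big_ord_recl /extend unlift_none mdistxx add0r.
by apply: eq_bigr => j _; rewrite liftK.
Qed.

Definition value_unif_continuous n (phi : formula L n) := forall eps, 0 < eps ->
  exists2 del : R, 0 < del & forall (N : structure L) (u v : 'I_n -> N),
    sum_dist u v < del -> `|value N phi u - value N phi v| < eps.

(** Quantifiers preserve uniform continuity because extending two tuples by the same point does not
    change their sum distance. *)
Lemma value_unif n (phi : formula L n) : value_unif_continuous phi.
Proof.
have sum_sym (X : metricType R) k (u v : 'I_k -> X) : sum_dist u v = sum_dist v u.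
  by apply: eq_bigr => j _; exact: metric_sym.
have scale k (psi : formula L k) r :
    value_unif_continuous psi -> value_unif_continuous (Scale r psi).
  (* The added [1] avoids a division by zero when [r = 0]. *)
  move=> ih e e0; have r0 : 0 < `|r| + 1 by rewrite ltr_wpDl.
  have [del d0 dP] := ih _ (divr_gt0 e0 r0); exists del => // N u v /dP.
  rewrite ltr_pdivlMr// /value/= -mulrBr normrM; apply: le_lt_trans.
  by rewrite mulrC ler_wpM2l// lerDl.
have sups k (psi : formula L k.+1) :
    value_unif_continuous psi -> value_unif_continuous (Sup psi).
  move=> ih e e0; have e20 : 0 < e / 2 by rewrite divr_gt0.
  have [del d0 dP] := ih _ e20; have [C CP] := value_bounded psi.
  exists del => // N.
  have [x0 _] := structure_nonempty N.
  (* Passing to the supremum loses strictness; the margin [e / 2] restores it, and exchanging [u]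
     and [v] gives the other side. *)
  have half u v : sum_dist u v < del ->
      value N (Sup psi) u <= value N (Sup psi) v + e / 2.
    move=> uv; apply: sup_family_le => [|x _]; first by exists x0.
    have := dP N (extend x u) (extend x v).
    rewrite sum_dist_extend => /(_ uv); rewrite ltr_norml => /andP[_ h].
    have h' : value N psi (extend x v) <= value N (Sup psi) v.
      exact: (sup_family_ge (h := fun x => value N psi (extend x v)) (fun x => CP N _)).
    by change (value N psi (extend x u) <= value N (Sup psi) v + e / 2); lra.
  move=> u v uv; have h1 := half _ _ uv.
  have := half v u; rewrite sum_sym => /(_ uv) h2.
  by rewrite ltr_norml; apply/andP; split; lra.
elim: phi => {n} [n P a|n r|n phi ih psi ih'|n r phi ih|n phi ih|n phi ih] eps e0.
- have [del0 d0 del0P] := pred_interp_unif P e0.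
  have [del del_gt0 delP] := term_unif_sum_dist (fun j => term_value_unif (a j)) d0.
  by exists del => // N u v uv; apply/del0P/delP.
- by exists 1 => // N u v _; rewrite /value/= subrr normr0.
- have e20 : 0 < eps / 2 by rewrite divr_gt0.
  have [del d0 dP] := ih _ e20; have [del' d0' dP'] := ih' _ e20.
  exists (Num.min del del'); first by rewrite lt_min d0.
  move=> N u v; rewrite lt_min => /andP[/dP + /dP'].
  by rewrite /value/= !ltr_norml => /andP[? ?] /andP[? ?]; apply/andP; split; lra.
- exact: scale.
- exact: sups.
- have [del d0 dP] := scale _ _ (-1) (sups _ _ (scale _ _ (-1) ih)) _ e0.
  by exists del => // N u v uv; rewrite !value_Inf; exact: dP.
Qed.

End syntax.

(** * Measurability of countable suprema and of selections by least index *)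

Section selection.
Variables (R : realType) (d : measure_display) (T : measurableType d).
Variable mu : probability T R.
Local Notation mm := (mu_measurable mu).

(** Off one null set, [S w > r] exactly when [h k w > r] for some [k]: take [eps = S w - r]. *)
Lemma mu_measurable_countable_sup (h : nat -> T -> R) (S : T -> R) :
  (forall k, mm (h k)) ->
  (\forall w \ae mu, (forall k, h k w <= S w) /\
    forall eps, 0 < eps -> exists k, S w - eps < h k w) ->
  mm S.
Proof.
move=> mh hS; have [N [mN N0 mNh PN]] := mu_measurable_common mh hS.
apply/mu_measurableP; exists N; split => // mD.
apply: (measurability _ (RGenOInfty.measurableE R)) => //.
move=> _ [_ [r ->] <-].
rewrite (_ : _ `&` _ = \bigcup_k (~` N `&` h k @^-1` `]r, +oo[)); last first.
  apply/seteqP; split => [w [Nw /=]|w [k _ [Nw /=]]]; rewrite !in_itv/= !andbT => rS.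
  - have [_ /(_ (S w - r))] := PN w Nw; rewrite subr_gt0 => /(_ rS)[k].
    by rewrite subKr => rk; exists k => //; split => //=; rewrite in_itv/= andbT.
  - by split => //; apply: lt_le_trans rS _; case: (PN w Nw).
by apply: bigcupT_measurable => k; apply: mNh => //; exact: measurable_itv.
Qed.

(** Off a null set, [K w = k] means that [u k w > 0] and [u i w <= 0] for all [i < k]. These
    measurable conditions cut the space into countably many pieces, with [F k] the selected function
    on the piece of index [k]. *)
Lemma mu_measurable_select (u F : nat -> T -> R) (K : T -> nat) :
  (forall k, mm (u k)) -> (forall k, mm (F k)) ->
  (\forall w \ae mu, 0 < u (K w) w /\ forall i, (i < K w)%N -> u i w <= 0) ->
  mm (fun w => F (K w) w).
Proof.
move=> mu0 mF uK.
have muF (x : nat + nat) : mm (match x with inl k => u k | inr k => F k end).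
  by case: x => k; [exact: mu0|exact: mF].
have [N [mN N0 mNuF PN]] := mu_measurable_common muF uK.
apply/mu_measurableP; exists N; split => // mD.
apply: (measurability _ (RGenInftyO.measurableE R)) => //.
move=> _ [_ [r ->] <-].
rewrite (_ : _ `&` _ = \bigcup_k ((~` N `&` F k @^-1` `]-oo, r[) `&`
    ((~` N `&` u k @^-1` `]0, +oo[) `&`
     \bigcap_(i in [set i | (i < k)%N]) (~` N `&` u i @^-1` `]-oo, 0])))); last first.
  apply/seteqP; split => [w [Nw /=]|w [k _ [[Nw /=]]]]; rewrite ?in_itv/=.
  - move=> Fr; have [u0 ui] := PN w Nw; exists (K w) => //; split; [|split].
    + by split => //=; rewrite in_itv.
    + by split => //=; rewrite in_itv/= andbT.
    + by move=> i /= iK; split => //=; rewrite in_itv/= ui.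
  - move=> Fr [[_ /=]]; rewrite ?in_itv/= andbT => uk0 uik.
    have [u0 ui] := PN w Nw; split => //=.
    have [Kk|kK|-> //] := ltngtP (K w) k.
    + by have [_ /=] := uik _ Kk; rewrite in_itv/= leNgt u0.
    + by have := ui _ kK; rewrite leNgt uk0.
apply: bigcupT_measurable => k; apply: measurableI; last apply: measurableI.
- by apply: (mNuF (inr k)) => //; exact: measurable_itv.
- by apply: (mNuF (inl k)) => //; exact: measurable_itv.
- apply: bigcap_measurableType => i _.
  by apply: (mNuF (inl i)) => //; exact: measurable_itv.
Qed.

End selection.

(** * Values of formulas in the direct integral *)

Section integral_of_values.
Variables (R : realType) (L : signature R) (d : measure_display).
Variables (T : measurableType d) (mu : probability T R).
Variables (M : T -> structure L) (I : Type) (e : I -> forall w, M w).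
Hypothesis mf : measurable_field mu e.
Local Notation mm := (mu_measurable mu).
Local Notation gen I0 w := (@generated R L d T M I e I0 w).
Local Notation DI := (direct_integral mf).

Lemma enumeration_section i : measurable_section mu e (e i).
Proof.
exists [set i]; split => //.
  by apply: aeW => w; apply: subset_closure; exists i.
by move=> k _; exact: (field_mdist mf).
Qed.

(** Pointwise evaluation yields an actual section [g], whereas the direct integral evaluates on
    chosen representatives. The two agree off a null set, hence as classes. *)
Lemma term_value_section n (t : term L n) (f : 'I_n -> msection mu e) :
  exists2 g : msection mu e, (forall w, g w = term_value (fun j => f j w) t) &
    @term_value R L DI n (fun j => section_class mf (f j)) t = section_class mf g.
Proof.
elim: t => [i|F a ih]; first by exists (f i).
have /choice[s sP] j : exists s : msection mu e,
    (forall w, s w = term_value (fun j => f j w) (a j)) /\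
    @term_value R L DI n (fun j => section_class mf (f j)) (a j) = section_class mf s.
  by have [s ? ?] := ih j; exists s.
exists (msection_app mf s) => [w|] /=.
  by congr fun_interp; apply/funext => j; exact: (sP j).1.
rewrite /direct_integral_fun; apply/section_classP.
(* A symbol has finitely many arguments, so the exceptional sets of their representatives have a
   null union. *)
have : \forall w \ae mu, forall j, repr (section_class mf (s j)) w = s j w.
  by apply: ae_forall => j; exact: repr_section_class.
apply: filterS => w reprs /=; congr fun_interp; apply/funext => j.
by rewrite (sP j).2 reprs.
Qed.

(** Sections rather than classes make the integrand a definite function of [w]. All tuples [f] are
    covered, since a quantifier extends the tuple by a further section. *)
Definition value_integral n (phi : formula L n) := forall f : 'I_n -> msection mu e,
  mm (fun w => value (M w) phi (fun j => f j w)) /\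
  value DI phi (fun j => section_class mf (f j)) =
    \int[mu]_w value (M w) phi (fun j => f j w).

Lemma bmm_value n (phi : formula L n) (f : 'I_n -> msection mu e) :
  value_integral phi -> bmm mu (fun w => value (M w) phi (fun j => f j w)).
Proof.
move=> /(_ f)[mphi _]; split => //.
by have [C CP] := value_bounded phi; exists C => w; exact: CP.
Qed.

(** Predicates of the direct integral are integrals by definition; the work lies in replacing the
    representatives of the term values by the sections [s j]. *)
Lemma value_integral_Atom n (P : pred_sym L) (a : 'I_(pred_arity P) -> term L n) :
  value_integral (Atom a).
Proof.
move=> f.
have /choice[s sP] j : exists s : msection mu e,
    (forall w, s w = term_value (fun j => f j w) (a j)) /\
    @term_value R L DI n (fun j => section_class mf (f j)) (a j) = section_class mf s.
  by have [s ? ?] := term_value_section (a j) f; exists s.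
have E : (fun w => value (M w) (Atom a) (fun j => f j w)) =
         (fun w => pred_interp (M w) P (fun j => s j w)).
  apply/funext => w; rewrite /value/=; congr pred_interp.
  by apply/funext => j; rewrite (sP j).1.
rewrite E; split; first by case: (bmm_pred mf s).
rewrite /value/= /direct_integral_pred; apply: ae_RintegralE.
have : \forall w \ae mu, forall j, repr (section_class mf (s j)) w = s j w.
  by apply: ae_forall => j; exact: repr_section_class.
apply: filterS => w reprs /=; congr pred_interp; apply/funext => j.
by rewrite (sP j).2 reprs.
Qed.

Lemma value_integral_Scale n r (phi : formula L n) :
  value_integral phi -> value_integral (Scale r phi).
Proof.
move=> phiP f; have bphi := bmm_value f phiP; split.
  exact: mu_measurableM (mu_measurable_cst _ _) bphi.1.
by rewrite [RHS](bmm_RintegralZ r bphi) -(phiP f).2.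
Qed.

Lemma value_integral_Add n (phi psi : formula L n) :
  value_integral phi -> value_integral psi -> value_integral (Add phi psi).
Proof.
move=> phiP psiP f; have bphi := bmm_value f phiP; have bpsi := bmm_value f psiP.
split; first exact: mu_measurableD bphi.1 bpsi.1.
by rewrite [RHS](bmm_RintegralD bphi bpsi) -(phiP f).2 -(psiP f).2.
Qed.

(** Half of [eps] pays for a near-optimal point [x] of the generated substructure, the other half
    for moving [x] to a nearby point of the enumeration. Neither [g] nor the null set depends on
    [eps]. *)
Lemma value_Sup_enumeration n (phi : formula L n.+1) (f : 'I_n -> msection mu e) :
  exists g : nat -> I, \forall w \ae mu, forall eps, 0 < eps -> exists k,
    value (M w) (Sup phi) (fun j => f j w) - eps <
    value (M w) phi (extend (e (g k) w) (fun j => f j w)).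
Proof.
have [F0 [P0 [fF fP phi0]]] := formula_over_finite phi.
have [g [fg Mg]] := common_range mf fF fP (fun j => msectionP (f j)).
exists g; apply: filterS2 Mg (ae_forall fg) => w [N0 _ affN] Nf eps e0.
set v := fun j => f j w.
have Nv j : gen (range g) w (v j) by exact: Nf.
have e20 : 0 < eps / 2 by rewrite divr_gt0.
(* Elementarity for [Sup phi] restricts the supremum to the generated set. *)
have SN := affN n (Sup phi) phi0 v Nv; rewrite -SN /=.
have hs : has_sup [set value_in (gen (range g) w) phi (extend x v) | x in gen (range g) w].
  split; first by have [x Nx] := N0; exists (value_in (gen (range g) w) phi (extend x v)), x.
  have [C CP] := value_bounded phi; exists C => _ [x Nx <-].
  rewrite affN//; last by move=> j; rewrite /extend; case: unlift.
  exact: le_trans (ler_norm _) (CP _ _).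
have [_ [x Nx <-]] := sup_adherent e20 hs.
(* Elementarity for [phi] itself removes the relativization under the supremum. *)
rewrite affN//; last by move=> j; rewrite /extend; case: unlift.
have [del d0 delP] := value_unif phi e20.
have /generated_range/(_ _ d0)[k xk] := Nx.
move=> h; exists k.
have := delP _ (extend x v) (extend (e (g k) w) v).
have -> : sum_dist (extend x v) (extend (e (g k) w) v) = mdist x (e (g k) w).
  rewrite /sum_dist big_ord_recl /extend unlift_none big1 ?addr0// => j _.
  by rewrite liftK mdistxx.
by move=> /(_ xk); rewrite ltr_norml => /andP[_ ?]; lra.
Qed.

Lemma value_integral_Sup n (phi : formula L n.+1) :
  value_integral phi -> value_integral (Sup phi).
Proof.
move=> phiP f; have [g gP] := value_Sup_enumeration phi f.
have [C CP] := value_bounded phi.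
pose v w := fun j => f j w.
pose S w := value (M w) (Sup phi) (v w).
pose val (s : msection mu e) w := value (M w) phi (extend (s w) (v w)).
have valE s : val s =
    fun w => value (M w) phi (fun j => (extend s f j : msection mu e) w).
  apply/funext => w; rewrite /val /v.
  by rewrite (extend_comp (fun s : msection mu e => s w)).
have bval s : bmm mu (val s) by rewrite valE; exact: bmm_value.
have valS s w : val s w <= S w.
  exact: (sup_family_ge (h := fun x => value (M w) phi (extend x (v w)))
    (fun x => CP _ _)).
pose eg k := MSection (enumeration_section (g k)).
have mS : mm S.
  apply: (@mu_measurable_countable_sup _ _ _ _ (fun k => val (eg k))) => [k|].
    exact: (bval _).1.
  by apply: filterS gP => w wP; split => // k; exact: valS.
have bS : bmm mu S.
  split=> //; have [D DP] := value_bounded (Sup phi).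
  by exists D => w; exact: DP.
(* The induction hypothesis for the tuple extended by [s]. *)
have valDI (s : msection mu e) :
    value DI phi (extend (section_class mf s) (fun j => section_class mf (f j))) =
    \int[mu]_w val s w.
  by rewrite valE -(phiP _).2 (extend_comp (section_class mf)).
(* Upper bound: each section [s] satisfies [val s <= S] pointwise. The lower bound needs a
   near-optimal section. *)
split=> //; apply/eqP; rewrite eq_le; apply/andP; split.
  apply: sup_family_le => [|p _].
    by exists (section_class mf (eg 0%N)).
  rewrite -[p]reprK.
  change (value DI phi (extend (section_class mf (repr p))
    (fun j => section_class mf (f j))) <= \int[mu]_w S w).
  rewrite valDI; apply: ae_le_Rintegral => //.
  by apply: aeW => w; exact: valS.
apply/ler_addgt0Pr => eps e0.
pose u k w := val (eg k) w - S w + eps.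
(* [0 < u k w] says that [e (g k) w] is [eps]-optimal at [w]. The default index [0] is reached only
   on a null set. *)
pose K w := if pselect (exists k, 0 < u k w) is left ex then ex_minn ex else 0%N.
have KP : \forall w \ae mu, 0 < u (K w) w /\ forall i, (i < K w)%N -> u i w <= 0.
  apply: filterS gP => w /(_ _ e0)[k]; rewrite -/(v w) -/(S w) -/(val (eg k) w) => hk.
  have uk : 0 < u k w by rewrite /u; lra.
  rewrite /K; case: pselect => [ex|]; last by case; exists k.
  case: ex_minnP => m um mmin; split => // i; rewrite leNgt ltnNge.
  by apply: contra => /mmin.
(* The selected section takes its values in the enumeration at every [w]; its distances to the [e i]
   are measurable by selection along [u]. *)
have sP : measurable_section mu e (fun w => e (g (K w)) w).
  exists (range g); split.
  - exact: card_image_le.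
  - by apply: aeW => w; apply: subset_closure; exists (g (K w)).
  - move=> i _.
    apply: (@mu_measurable_select _ _ _ _ u (fun k w => mdist (e (g k) w) (e i w)) K) => // k.
    + apply: mu_measurableD; last exact: mu_measurable_cst.
      exact: mu_measurableB (bval _).1 mS.
    + exact: (field_mdist mf).
pose s := MSection sP.
have : \int[mu]_w (S w - eps) <= \int[mu]_w val s w.
  apply: ae_le_Rintegral => //; first exact: bmmB bS (bmm_cst _ _).
  by apply: filterS KP => w [+ _]; rewrite /u /val/= => ?; lra.
rewrite bmm_RintegralB//; last exact: bmm_cst.
rewrite Rintegral_prob_cst -valDI lerBlDr => /le_trans; apply; rewrite lerD2r.
exact: (sup_family_ge (h := fun p => value DI phi (extend p _)) (fun x => CP _ _)).
Qed.

(** The infimum is the opposite of the supremum of the opposite formula, so the [Scale] and [Sup]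
    cases combine. *)
Lemma value_integral_Inf n (phi : formula L n.+1) :
  value_integral phi -> value_integral (Inf phi).
Proof.
move=> /(value_integral_Scale (-1))/value_integral_Sup/(value_integral_Scale (-1)) h f.
have [mh hE] := h f; rewrite value_Inf.
have -> : (fun w => value (M w) (Inf phi) (fun j => f j w)) =
    fun w => value (M w) (Scale (-1) (Sup (Scale (-1) phi))) (fun j => f j w).
  by apply/funext => w; exact: value_Inf.
by split.
Qed.

End integral_of_values.

Theorem theorem8p11 (R : realType) (L : signature R) (d : measure_display)
    (T : measurableType d) (mu : probability T R) (M : T -> structure L)
    (I : Type) (e : I -> forall w : T, M w) (mf : measurable_field mu e)
    (n : nat) (phi : formula L n) (f : 'I_n -> msection mu e) :
  mu_measurable mu (fun w : T => value (M w) phi (fun j => f j w)) /\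
  value (direct_integral mf) phi (fun j => section_class mf (f j)) =
    \int[mu]_w value (M w) phi (fun j => f j w).
Proof.
move: f; elim: phi => {n} [n P a|n r|n phi ih psi ih'|n r phi ih|n phi ih|n phi ih].
- exact: value_integral_Atom.
- move=> f; split; first exact: mu_measurable_cst.
  by rewrite /value/= (Rintegral_prob_cst mu r).
- exact: value_integral_Add.
- exact: value_integral_Scale.
- exact: value_integral_Sup.
- exact: value_integral_Inf.
Qed.
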